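(* For any simple graph $G$ with $m$ edges, $P_l(G,k)=P(G,k)$ holds for each $k\in\mathbb N$ with $k\ge m-1$.
   Context: Graphs are finite. $\mathbb N$ is the set of positive integers and $[k]=\{1,\dots,k\}$. $P(G,k)$ is the number of proper $k$-colorings of $G$, i.e. maps $f:V(G)\to[k]$ with $f(u)\ne f(v)$ for every edge $uv$. A $k$-assignment of $G$ is a map $L:V(G)\to 2^{\mathbb N}$ with $|L(v)|=k$ for all $v\in V(G)$. An $L$-coloring is a map $f:V(G)\to\mathbb N$ with $f(v)\in L(v)$ for each $v$ and $f(u)\ne f(v)$ for each pair of adjacent vertices $u,v$; $P(G,L)$ is the number of $L$-colorings. $P_l(G,k)$ (the list-color function) is the minimum of $P(G,L)$ over all $k$-assignments $L$ of $G$. *)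

(* Defs.v *)
From mathcomp Require Import all_boot finmap boolp.

Set Implicit Arguments.
Unset Strict Implicit.
Unset Printing Implicit Defensive.

Record sgraph := SGraph {
  vertex :> finType;
  adj : rel vertex;
  adj_sym : symmetric adj;
  adj_irr : irreflexive adj
}.

Definition edges (G : sgraph) : {set {set G}} :=
  [set [set p.1; p.2] | p : G * G & adj p.1 p.2].

(* The colour set {1, ..., k} is represented by 'I_k = {0, ..., k - 1}. *)
Definition chromatic_fun (G : sgraph) (k : nat) : nat :=
  #|[set f : {ffun G -> 'I_k} | [forall u, forall v, adj u v ==> (f u != f v)]]|.

(* Colours are positive integers, hence the exclusion of 0. *)
Definition is_assignment (G : sgraph) (k : nat) (L : G -> {fset nat}) : Prop :=
  forall v : G, 0 \notin L v /\ #|` L v|%fset = k.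

Definition palette (G : sgraph) (L : G -> {fset nat}) : {fset nat} :=
  (\bigcup_(v <- enum G) L v)%fset.

(* Every L-colouring takes its values in the finite set [palette L], so nothing
   is lost by counting maps to [palette L] instead of maps to nat. *)
Definition num_list_colorings (G : sgraph) (L : G -> {fset nat}) : nat :=
  #|[set f : {ffun G -> palette L} |
      [forall v, val (f v) \in L v] &&
      [forall u, forall v, adj u v ==> (val (f u) != val (f v))]]|.

Lemma ex_num_list_colorings (G : sgraph) (k : nat) :
  exists n, `[< exists2 L : G -> {fset nat},
                  is_assignment k L & num_list_colorings L = n >].
Proof.
pose L (_ : G) : {fset nat} := [fset i in iota 1 k]%fset.
exists (num_list_colorings L); apply/asboolP; exists L => // v; split.
  by rewrite in_fset mem_iota.
by rewrite card_fseq undup_id ?iota_uniq // size_iota.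
Qed.

(* The minimum of [num_list_colorings L] over all k-assignments L of G. *)
Definition list_color_fun (G : sgraph) (k : nat) : nat :=
  ex_minn (ex_num_list_colorings G k).

(* Main.v *)
Require Import Defs.
From mathcomp Require Import all_boot finmap boolp.
From mathcomp Require Import ssralg ssrnum ssrint order.
From mathcomp Require Import zify.

Set Implicit Arguments.
Unset Strict Implicit.
Unset Printing Implicit Defensive.

(* By the broken-circuit expansion with respect to a fixed edge order,
     P(G, L) = sum of (-1)^|B| beta(B) over the edge sets B without broken circuit,
   where beta(B) counts the L-colourings constant on the components of the
   forest (V, B). For constant lists beta(B) = k^(n-|B|), so P(G, L) - P(G, k) is
   the alternating sum D_1 - D_2 + D_3 - ..., where D_i adds up the deficiencies
   D(B) = k^(n-|B|) - beta(B) with |B| = i. Let d(uv) = |L(u) \ L(v)|. A union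
   bound gives k D(B) <= k^(n-|B|) * (sum of d over B), whereas
   D(B - e) >= k^(n-|B|) d(f) for distinct e, f in B; hence
   k D(B) <= sum over e in B of D(B - e) as soon as |B| >= 2. Each B of size i
   arises as some B' - e in at most m - i ways, so
   k D_(i+1) <= (m - i) D_i <= k D_i for i >= 1, and the alternating sum is
   nonnegative. *)

Import Order.TTheory GRing.Theory Num.Theory.

(** * Bounds for alternating sums and for products *)

Lemma alternating_sum_bounds (a : nat -> int) (n : nat) :
  (forall i, 0 <= a i)%R -> (forall i, a i.+1 <= a i)%R ->
  (0 <= \sum_(i < n) (-1) ^+ i * a i <= a 0)%R.
Proof.
elim: n a => [|n IHn] a a_ge0 a_decr; first by rewrite big_ord0 lexx a_ge0.
(* The induction is two-sided: nonnegativity of the whole sum comes from the upper bound on the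
   shifted one. *)
have /andP[s_ge0 s_le] := IHn (a \o S) (fun i => a_ge0 i.+1) (fun i => a_decr i.+1).
have ->: (\sum_(i < n.+1) (-1) ^+ i * a i =
          a 0 - \sum_(i < n) (-1) ^+ i * (a \o S) i)%R.
  rewrite big_ord_recl expr0 mul1r -sumrN; congr (_ + _)%R.
  by apply: eq_bigr => i _; rewrite /= exprS mulN1r mulNr.
rewrite subr_ge0 (le_trans s_le (a_decr 0)) /=.
by rewrite gerBl.
Qed.

Lemma prod_leq_exp (I : finType) (P : pred I) (p : I -> nat) (k : nat) :
  (forall i, P i -> p i <= k) -> \prod_(i | P i) p i <= k ^ #|[set i | P i]|.
Proof.
move=> p_le; have ->: #|[set i | P i]| = #|P| by apply: eq_card => i; rewrite inE.
by rewrite -prod_nat_const; apply: leq_prod => i /p_le.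
Qed.

(** The union bound: replacing a factor [k] by [p i] costs at most [k - p i] times a power of [k].
    Multiplying by [k] avoids the exponent c - 1, which would be truncated for an empty product. *)
Lemma prod_geq_exp (I : finType) (P : pred I) (p : I -> nat) (k : nat) :
  (forall i, P i -> p i <= k) ->
  k ^ #|[set i | P i]|.+1 <=
    k * \prod_(i | P i) p i + k ^ #|[set i | P i]| * \sum_(i | P i) (k - p i).
Proof.
move=> p_le; have ->: #|[set i | P i]| = count P (index_enum I).
  by rewrite cardsE cardE /enum_mem size_filter; apply: eq_count.
elim: (index_enum I) => [|i s IHs]; first by rewrite !big_nil expn0 expn1 muln1 addn0.
rewrite !big_cons /=; case: ifP => [Pi|_]; last by [].
have {p_le} pi_le := p_le i Pi; rewrite add1n.
move: IHs; set c := count P s; set q := \prod_(j <- s | P j) p j.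
set d := \sum_(j <- s | P j) (k - p j); rewrite !expnS => IHs.
nia.
Qed.

(** * Contracting a forest of edges, and counting the colourings constant on its components *)

Section Contraction.

Variables (V T K : finType) (s t : T -> V) (M : V -> {set K}) (k : nat).
Hypothesis card_M : forall v, #|M v| = k.

Definition compat (C : eqType) (f : V -> C) (B : {set T}) :=
  [forall e in B, f (s e) == f (t e)].

Lemma compatP (C : eqType) (f : V -> C) (B : {set T}) :
  reflect {in B, forall e, f (s e) = f (t e)} (compat f B).
Proof. exact: 'forall_in_eqP. Qed.

(* e is spanned by B when its ends lie in the same component of (V, B);
   two-valued functions are enough to separate components. *)
Definition spanned (B : {set T}) (e : T) :=
  [forall g : {ffun V -> bool}, compat g B ==> (g (s e) == g (t e))].

Lemma spanned_compat (C : eqType) (f : V -> C) (B : {set T}) (e : T) :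
  spanned B e -> compat f B -> f (s e) = f (t e).
Proof.
(* The two-valued test function is the indicator of the fibre of [f] through [s e]. *)
move=> /forallP/(_ [ffun x => f x == f (s e)])/implyP sp /compatP fB.
have /sp : compat [ffun x => f x == f (s e)] B.
  by apply/compatP => e' /fB; rewrite !ffunE => ->.
by rewrite !ffunE eqxx => /eqP/esym/eqP.
Qed.

Lemma spannedS (A B : {set T}) (e : T) : A \subset B -> spanned A e -> spanned B e.
Proof.
move=> /subsetP sAB sp; apply/forallP => g; apply/implyP => /compatP gB.
by apply/eqP/(spanned_compat sp)/compatP => e' /sAB/gB.
Qed.

(** The intersection of the lists over the component rooted at [x]. Under an idempotent [r], a
    non-root has an empty fibre and gets all of [K], so sums and products run over roots only. *)
Definition common (r : V -> V) (x : V) : {set K} :=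
  [set c | [forall y, (r y == x) ==> (c \in M y)]].

Definition defect (e : T) := #|M (s e) :\: M (t e)|.

(* r sends every vertex to the root of its component; the cardinality condition
   says that (V, B) is a forest. *)
Definition contraction (r : V -> V) (B : {set T}) : Prop :=
  [/\ forall x, r (r x) = r x,
      {in B, forall e, r (s e) = r (t e)},
      forall (C : eqType) (f : V -> C), compat f B -> forall x, f (r x) = f x,
      #|[set x | r x == x]| + #|B| = #|V| &
      \sum_(x | r x == x) (k - #|common r x|) <= \sum_(e in B) defect e].

Lemma common_sub (r : V -> V) (y : V) : common r (r y) \subset M y.
Proof. by apply/subsetP => c; rewrite inE => /forallP/(_ y); rewrite eqxx. Qed.

Lemma contraction_set0 : contraction id set0.
Proof.
split=> //; first by move=> e; rewrite inE.
  rewrite cards0 addn0 cardsE; apply: eq_card => x; rewrite inE; exact: eqxx.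
rewrite big_set0 big1 // => x _.
suff ->: common id x = M x by rewrite card_M subnn.
apply/setP => c; rewrite inE; apply/forallP/idP => [/(_ x)|cM y]; first by rewrite eqxx.
by apply/implyP => /eqP ->.
Qed.

(** A colour of [M u] outside X ∩ Y is missing from [X], or lies in [M v] but not in [Y], or is
    missing from [M v]. *)
Lemma deficit_setI (X Y : {set K}) (u v : V) :
  X \subset M u -> Y \subset M v ->
  k - #|X :&: Y| <= (k - #|X|) + (k - #|Y|) + #|M u :\: M v|.
Proof.
move=> sX sY.
have -> : k - #|X| = #|M u :\: X| by rewrite cardsDS ?card_M.
have -> : k - #|Y| = #|M v :\: Y| by rewrite cardsDS ?card_M.
have -> : k - #|X :&: Y| = #|M u :\: (X :&: Y)|.
  by rewrite cardsDS ?card_M // (subset_trans (subsetIl _ _)).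
apply: leq_trans (leq_trans (leq_card_setU _ _) (leq_add (leq_card_setU _ _) (leqnn _))).
apply/subset_leq_card/subsetP => c; rewrite !inE.
by case: (c \in X); case: (c \in Y); case: (c \in M u); case: (c \in M v).
Qed.

(** An unspanned edge joins two components, which some [g] constant on components separates.
    Redirecting the root [r v] to [r u] removes one root and intersects two common lists;
    [deficit_setI] charges the extra loss to [defect e]. *)
Lemma contraction_extend (r : V -> V) (B : {set T}) (e : T) :
  contraction r B -> e \notin B -> ~~ spanned B e ->
  exists r', contraction r' (e |: B).
Proof.
move=> [rK rB rf cardB defB] eNB /forallPn[g]; rewrite negb_imply => /andP[gB g_ne].
set u := s e; set v := t e.
have ruv : r u != r v.
  by apply: contraNneq g_ne => ruv; rewrite -/u -/v -(rf _ _ gB u) -(rf _ _ gB v) ruv.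
pose r' x := if r x == r v then r u else r x.
have r'u : r' u = r u by rewrite /r' (negPf ruv).
have r'v : r' v = r u by rewrite /r' eqxx.
have root' x : (r' x == x) = (r x == x) && (x != r v).
  rewrite /r'; have [rxv|rxv] := eqVneq (r x) (r v).
    rewrite -rxv [x == _]eq_sym andbN; apply/eqP => rux.
    by move: ruv; rewrite -rxv -rux rK eqxx.
  by case: (r x =P x) => //= rx; rewrite -{1}rx rxv.
have comE x : x != r u -> x != r v -> common r' x = common r x.
  move=> xu xv; apply/setP => c; rewrite !inE; apply: eq_forallb => y; congr (_ ==> _).
  rewrite /r'; case: (r y =P r v) => [->|//].
  by rewrite [r u == x]eq_sym [r v == x]eq_sym (negPf xu) (negPf xv).
have comI : common r' (r u) = common r (r u) :&: common r (r v).
  apply/setP => c; rewrite !inE; apply/forallP/andP => [h|[/forallP hu /forallP hv] y].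
    split; apply/forallP => y; apply/implyP => /eqP ry; have /implyP := h y; apply;
      by rewrite /r' ry ?(negPf ruv) eqxx.
  apply/implyP; rewrite /r'; case: ifP => [ryv _|_ ryu].
    exact: implyP (hv y) _.
  exact: implyP (hu y) _.
exists r'; split.
- move=> x; rewrite {2 3}/r'; case: ifP => [_|/negbT rxv].
    by rewrite /r' rK (negPf ruv).
  by rewrite /r' rK (negPf rxv).
- move=> e'; rewrite !inE => /predU1P[->|/rB rE]; first by rewrite r'u r'v.
  by rewrite /r' rE.
- move=> C f /compatP fB x.
  have fuv : f u = f v by apply: fB; rewrite !inE eqxx.
  have fB' : compat f B by apply/compatP => e' e'B; apply: fB; rewrite !inE e'B orbT.
  rewrite /r'; case: ifP => [/eqP rxv|_]; last exact: rf.
  by rewrite rf // fuv -(rf _ _ fB' x) rxv rf.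
- have -> : [set x | r' x == x] = [set x | r x == x] :\ r v.
    by apply/setP => x; rewrite !inE root' andbC.
  rewrite cardsU1 eNB -cardB [in RHS](cardsD1 (r v)) inE rK eqxx.
  by rewrite addnCA add1n.
rewrite big_setU1 //=.
under eq_bigl => x do rewrite root'.
rewrite (bigD1 (r u)) ?rK ?eqxx ?ruv //= comI.
move: defB; rewrite (bigD1 (r v)) ?rK ?eqxx //= (bigD1 (r u)) ?rK ?eqxx ?ruv //=.
have -> : \sum_(i | (r i == i) && (i != r v) && (i != r u)) (k - #|common r' i|)
        = \sum_(i | (r i == i) && (i != r v) && (i != r u)) (k - #|common r i|).
  by apply: eq_bigr => x /andP[/andP[_ xv] xu]; rewrite comE.
have := deficit_setI (common_sub r u) (common_sub r v).
rewrite /defect -/u -/v; lia.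
Qed.

Definition beta (B : {set T}) :=
  #|[set f : {ffun V -> K} | [forall v, f v \in M v] && compat f B]|.

(** A colouring constant on components amounts to a free choice, at each root, of a colour common to
    its component. *)
Lemma betaE (r : V -> V) (B : {set T}) :
  contraction r B -> beta B = \prod_(x | r x == x) #|common r x|.
Proof.
move=> [rK rB rf _ _].
pose R := {x | r x == x}.
pose F (x : R) : pred K := mem (common r (val x)).
have rP x : r (r x) == r x by rewrite rK.
pose restr (f : {ffun V -> K}) : {ffun R -> K} := [ffun x : R => f (val x)].
transitivity #|family F|; last first.
  rewrite card_family foldrE big_map big_enum /=.
  by rewrite -(big_sub [pred x | r x == x] (fun x => #|common r x|)).
rewrite /beta; set S := [set f | _].
have restr_inj : {in S &, injective restr}.
  move=> f g; rewrite !inE => /andP[_ fB] /andP[_ gB] /ffunP fg; apply/ffunP => x.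
  have := fg (exist _ (r x) (rP x)); rewrite !ffunE /=.
  by rewrite (rf _ _ fB) (rf _ _ gB).
rewrite -(card_in_imset restr_inj); apply: eq_card => g; apply/imsetP/familyP.
  move=> [f]; rewrite inE => /andP[/forallP fM fB] -> x.
  rewrite ffunE inE; apply/forallP => y; apply/implyP => /eqP <-.
  by rewrite (rf _ _ fB).
move=> gF; exists [ffun x => g (exist _ (r x) (rP x))].
  rewrite inE; apply/andP; split.
    apply/forallP => x; rewrite ffunE.
    by apply: (subsetP (common_sub r x)); apply: gF.
  by apply/compatP => e eB; rewrite !ffunE; congr (g _); apply: val_inj; rewrite /= rB.
apply/ffunP => x; rewrite !ffunE; congr (g _); apply: val_inj => /=.
by rewrite (eqP (valP x)).
Qed.

Lemma common_leq (r : V -> V) (x : V) : r x == x -> #|common r x| <= k.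
Proof. by move=> /eqP rx; rewrite -(card_M x) subset_leq_card // -{1}rx common_sub. Qed.

Lemma contraction_card (r : V -> V) (B : {set T}) :
  contraction r B -> #|[set x | r x == x]| = #|V| - #|B|.
Proof. by case=> _ _ _ <- _; rewrite addnK. Qed.

Lemma beta_leq (r : V -> V) (B : {set T}) :
  contraction r B -> beta B <= k ^ (#|V| - #|B|).
Proof.
move=> rB; rewrite (betaE rB) -(contraction_card rB).
apply: prod_leq_exp => x; exact: common_leq.
Qed.

Lemma beta_geq (r : V -> V) (B : {set T}) : contraction r B ->
  k ^ (#|V| - #|B|).+1 <= k * beta B + k ^ (#|V| - #|B|) * \sum_(e in B) defect e.
Proof.
move=> rB; rewrite (betaE rB) -(contraction_card rB).
apply: leq_trans (prod_geq_exp _) _; first by move=> x; apply: common_leq.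
by case: rB => _ _ _ _ h; rewrite leq_add2l leq_mul2l h orbT.
Qed.

(** The common colours of the component of [e] lie in both end lists, so there are at most
    [k - defect e] of them; every other component has at most [k]. *)
Lemma beta_defect (r : V -> V) (B : {set T}) (e : T) : contraction r B -> e \in B ->
  k * beta B + k ^ (#|V| - #|B|) * defect e <= k ^ (#|V| - #|B|).+1.
Proof.
move=> rB eB; have := contraction_card rB; rewrite (betaE rB) => <-.
have [rK /(_ _ eB) rst _ _ _] := rB.
have com_le : #|common r (r (s e))| + defect e <= k.
  rewrite -(card_M (s e)) -(cardsID (M (t e)) (M (s e))) /defect leq_add2r.
  by rewrite subset_leq_card // subsetI common_sub rst common_sub.
have rr : r (r (s e)) == r (s e) by rewrite rK.
rewrite (bigD1 (r (s e))) //=.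
have := @prod_leq_exp _ [pred x | (r x == x) && (x != r (s e))]
  (fun x => #|common r x|) k.
move=> /(_ (fun x h => common_leq (proj1 (andP h)))) /=.
set p := \prod_(_ | _) _; set q := #|common _ _| in com_le *.
have -> : #|[set x | r x == x]| = #|[set x | (r x == x) && (x != r (s e))]|.+1.
  rewrite (cardsD1 (r (s e))) inE rr add1n; congr _.+1.
  by apply: eq_card => x; rewrite !inE andbC.
move: #|[set x | _ && _]| (defect e) com_le => c d com_le p_le.
rewrite !expnS -!mulnA -mulnDr leq_mul2l [_ * d]mulnC [k * _]mulnC.
apply/orP; right; apply: leq_trans (leq_mul (leqnn _) com_le).
by rewrite mulnDr [d * _]mulnC leq_add2r mulnC leq_mul2r p_le orbT.
Qed.

End Contraction.

(** * Edge sets without broken circuits *)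

Section BrokenCircuits.

Variables (V T : finType) (s t : T -> V).

(* Listing the edges as [E], the [nbc set0 E] are the edge sets in which no edge
   of [E] is spanned by the chosen edges preceding it, i.e. the sets without
   broken circuits; they are closed under taking subsets. *)
Fixpoint nbc (A : {set T}) (E : seq T) : seq {set T} :=
  if E is e :: E' then
    if spanned s t A e then [::] else nbc A E' ++ nbc (e |: A) E'
  else [:: A].

Lemma nbc_sub (A B : {set T}) (E : seq T) :
  B \in nbc A E -> A \subset B /\ B \subset A :|: [set:: E].
Proof.
elim: E A => [|e E IHE] A /=.
  by rewrite inE => /eqP ->; split=> //; apply: subsetUl.
case: ifP => // _; rewrite mem_cat => /orP[/IHE[AB BA]|/IHE[]].
  split=> //; apply: subset_trans BA _; apply: setUS.
  by apply/subsetP => x; rewrite !inE => ->; rewrite orbT.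
rewrite subUset => /andP[_ AB] BA; split=> //; apply: subset_trans BA _.
by apply/subsetP => x; rewrite !inE; do ![case: (_ == _) | case: (_ \in _)].
Qed.

Lemma nbc_mem (A B : {set T}) (E : seq T) (e : T) :
  B \in nbc A E -> e \notin A -> e \notin E -> e \notin B.
Proof.
move=> /nbc_sub[_ /subsetP sB] eNA eNE; apply/negP => /sB.
by rewrite !inE (negPf eNA) (negPf eNE).
Qed.

Lemma notin_setU1 (A : {set T}) (E : seq T) (e : T) :
  e \notin E -> {in E, forall e', e' \notin A} -> {in E, forall e', e' \notin e |: A}.
Proof.
move=> eNE EA e' e'E; rewrite !inE negb_or EA // andbT.
by apply: contraNneq eNE => <-.
Qed.

Lemma nbc_uniq (A : {set T}) (E : seq T) :
  uniq E -> {in E, forall e, e \notin A} -> uniq (nbc A E).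
Proof.
elim: E A => //= e E IHE A /andP[eNE uE] EA; case: ifP => // _.
have eNA : e \notin A by apply: EA; rewrite mem_head.
have EA' : {in E, forall e', e' \notin A}.
  by move=> e' e'E; apply: EA; rewrite inE e'E orbT.
rewrite cat_uniq IHE //= IHE //; last exact: notin_setU1.
rewrite andbT; apply/hasPn => B /nbc_sub[]; rewrite subUset sub1set => /andP[eB _] _.
by apply/negP => /nbc_mem/(_ eNA eNE); rewrite eB.
Qed.

(** Run the recursion for [B] and [B'] in parallel, keeping the edges chosen for [B'] among those
    chosen for [B]. By [spannedS] an edge not spanned on the larger side is not spanned on the
    smaller one, so the run for [B'] is never cut off. *)
Lemma nbc_subset (A A' B B' : {set T}) (E : seq T) :
  uniq E -> {in E, forall e, e \notin A} -> B \in nbc A E ->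
  A' \subset A -> A' \subset B' -> B' \subset A' :|: [set:: E] -> B' \subset B ->
  B' \in nbc A' E.
Proof.
elim: E A A' => [|e E IHE] A A' /=.
  move=> _ _ _ _ AB BA _; rewrite inE eqEsubset AB andbT.
  by apply: subset_trans BA _; apply/subsetP => x; rewrite !inE orbF.
move=> /andP[eNE uE] EA; case: ifP => // /negbT nspA BnA sA' AB BA BB.
have eNA : e \notin A by apply: EA; rewrite mem_head.
have EA' : {in E, forall e', e' \notin A}.
  by move=> e' e'E; apply: EA; rewrite inE e'E orbT.
have EeA := notin_setU1 eNE EA'.
rewrite (negPf (contra (spannedS sA') nspA)) mem_cat.
move: BnA; rewrite mem_cat; have [eB'|eNB'] := boolP (e \in B').
  case/orP => BnA; first by move/(nbc_mem BnA eNA)/negP: eNE; rewrite (subsetP BB).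
  apply/orP; right; apply: IHE BnA _ _ _ BB => //; first exact: setUS.
    by rewrite subUset sub1set eB'.
  apply: subset_trans BA _.
  by apply/subsetP => x; rewrite !inE; do ![case: (_ == _) | case: (_ \in _)].
have BA' : B' \subset A' :|: [set:: E].
  apply/subsetP => x xB'; have := subsetP BA x xB'; rewrite !inE.
  by case: eqP => // xe; rewrite -xe xB' in eNB'.
move=> BnA; apply/orP; left; case/orP: BnA => BnA; first exact: IHE BnA _ _ _ BB.
by apply: IHE BnA _ _ _ BB => //; apply: subset_trans sA' (subsetUr _ _).
Qed.

(** * Broken-circuit expansion of the number of colourings *)

Section Lists.

Variables (K : finType) (M : V -> {set K}) (k : nat).
Hypothesis card_M : forall v, #|M v| = k.

(** Edges in [A] are contracted, edges in [E] still have to be properly coloured; this interpolates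
    between proper colourings ([A] empty) and [beta] ([E] empty). *)
Definition num_colorings (A : {set T}) (E : seq T) :=
  #|[set f : {ffun V -> K} | [&& [forall v, f v \in M v], compat s t f A &
                                all (fun e => f (s e) != f (t e)) E]]|.

Lemma num_colorings_spanned (A : {set T}) (e : T) (E : seq T) :
  spanned s t A e -> num_colorings A (e :: E) = 0.
Proof.
move=> sp; apply/eqP; rewrite cards_eq0; apply/eqP/setP => f; rewrite !inE.
apply/negP => /and3P[_ fA /= /andP[/eqP ne _]]; apply: ne.
exact: spanned_compat sp fA.
Qed.

(** Deletion-contraction: split by whether the ends of [e] receive different colours. *)
Lemma num_colorings_cons (A : {set T}) (e : T) (E : seq T) :
  num_colorings A E = num_colorings A (e :: E) + num_colorings (e |: A) E.
Proof.
rewrite /num_colorings -(cardsID [set f : {ffun V -> K} | f (s e) != f (t e)]).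
congr (_ + _); apply: eq_card => f; rewrite !inE /=.
  by rewrite -!andbA; do !bool_congr.
have -> : compat s t f (e |: A) = (f (s e) == f (t e)) && compat s t f A.
  apply/compatP/andP => [h|[/eqP fe /compatP h] e'].
    split; first by apply/eqP/h; rewrite !inE eqxx.
    by apply/compatP => e' e'A; apply: h; rewrite !inE e'A orbT.
  by rewrite !inE => /predU1P[->|/h].
by rewrite negbK; do ![case: (_ == _) | case: [forall _, _] | case: compat].
Qed.

(** Iterated deletion-contraction: each contraction flips the sign, and a spanned edge makes the
    count zero exactly where [nbc] is cut off. *)
Lemma num_colorings_nbc (A : {set T}) (E : seq T) :
  uniq E -> {in E, forall e, e \notin A} ->
  ((-1) ^+ #|A| * (num_colorings A E)%:Z =
   \sum_(B <- nbc A E) (-1) ^+ #|B| * (beta s t M B)%:Z)%R.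
Proof.
elim: E A => [|e E IHE] A /=.
  move=> _ _; rewrite big_seq1 /num_colorings /beta; congr (_ * Posz _)%R.
  by apply: eq_card => f; rewrite !inE /= andbT.
move=> /andP[eNE uE] EA; case: ifP => sp.
  by rewrite num_colorings_spanned // mulr0 big_nil.
have eNA : e \notin A by apply: EA; rewrite mem_head.
have EA' : {in E, forall e', e' \notin A}.
  by move=> e' e'E; apply: EA; rewrite inE e'E orbT.
rewrite big_cat /= -!IHE //; last exact: notin_setU1.
by rewrite (num_colorings_cons A e E) PoszD cardsU1 eNA exprS mulrDr mulN1r mulNr addrK.
Qed.

Lemma nbc_contraction (A B : {set T}) (E : seq T) :
  uniq E -> {in E, forall e, e \notin A} ->
  (exists r, contraction s t M k r A) -> B \in nbc A E ->
  exists r, contraction s t M k r B.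
Proof.
elim: E A => [|e E IHE] A /=; first by move=> _ _ ? ; rewrite inE => /eqP ->.
move=> /andP[eNE uE] EA [r rA]; case: ifP => // /negbT sp.
have eNA : e \notin A by apply: EA; rewrite mem_head.
have EA' : {in E, forall e', e' \notin A}.
  by move=> e' e'E; apply: EA; rewrite inE e'E orbT.
rewrite mem_cat => /orP[|]; apply: IHE => //; first by exists r.
  exact: notin_setU1.
exact: contraction_extend rA eNA sp.
Qed.

(** Only the forests without broken circuits for the order of [enum T], not all forests. *)
Definition forests : {set {set T}} := [set B in nbc set0 (enum T)].

Lemma forests_contraction (B : {set T}) :
  B \in forests -> exists r, contraction s t M k r B.
Proof.
rewrite inE; apply: nbc_contraction; rewrite ?enum_uniq //.
  by move=> e _; rewrite inE.
by exists id; apply: contraction_set0.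
Qed.

Lemma forestsD1 (B : {set T}) (e : T) : B \in forests -> B :\ e \in forests.
Proof.
rewrite !inE => BF.
apply: (nbc_subset (enum_uniq T) _ BF); rewrite ?sub0set ?subsetDl //.
  by move=> ? _; rewrite inE.
by apply/subsetP => x _; rewrite !inE mem_enum orbT.
Qed.

Lemma num_colorings_forests :
  ((num_colorings set0 (enum T))%:Z =
   \sum_(B in forests) (-1) ^+ #|B| * (beta s t M B)%:Z)%R.
Proof.
have E0 : {in enum T, forall e, e \notin (set0 : {set T})} by move=> e _; rewrite inE.
have := num_colorings_nbc (enum_uniq T) E0; rewrite cards0 expr0 mul1r => ->.
by rewrite big_uniq ?nbc_uniq ?enum_uniq //=; apply: eq_bigl => B; rewrite inE.
Qed.

(** * Deficiencies and their sums over forests of a given size *)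

Definition deficiency (B : {set T}) := k ^ (#|V| - #|B|) - beta s t M B.

Lemma deficiency_leq (B : {set T}) : B \in forests ->
  k * deficiency B <= k ^ (#|V| - #|B|) * \sum_(e in B) defect s t M e.
Proof.
move=> /forests_contraction[r rB].
by rewrite /deficiency mulnBr -expnS leq_subLR; apply: beta_geq rB.
Qed.

Lemma deficiency_geq (B : {set T}) (e f : T) : 0 < k -> B \in forests ->
  e \in B -> f \in B -> f != e ->
  k ^ (#|V| - #|B|) * defect s t M f <= deficiency (B :\ e).
Proof.
move=> k_gt0 BF eB fB fe; have [r rB] := forests_contraction BF.
have [r' rB'] := forests_contraction (forestsD1 e BF).
have fB' : f \in B :\ e by rewrite !inE fe.
have := beta_defect card_M rB' fB'; rewrite /deficiency.
(* The root count of a forest keeps the subtraction from being truncated, so removing [e] raises the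
   exponent by exactly one. *)
have -> : #|V| - #|B :\ e| = (#|V| - #|B|).+1.
  have := cardsD1 e B; rewrite eB; have [rK _ _ cardB _] := rB.
  have : 0 < #|[set x | r x == x]| by apply/card_gt0P; exists (r (s e)); rewrite inE rK.
  lia.
rewrite !expnS -mulnA -mulnDr leq_mul2l; lia.
Qed.

Lemma deficiency_sum (B : {set T}) : 0 < k -> B \in forests -> 1 < #|B| ->
  k * deficiency B <= \sum_(e in B) deficiency (B :\ e).
Proof.
move=> k_gt0 BF B_gt1; set c := k ^ (#|V| - #|B|).
have /card_gt0P[b bB] : 0 < #|B| by apply: ltnW.
have [e0 e0B e0_max] : exists2 e0, e0 \in B &
    {in B, forall e, defect s t M e <= defect s t M e0}.
  by case: (arg_maxnP (defect s t M) bB) => e0; exists e0.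
have [e1] : exists e1, e1 \in B :\ e0.
  by apply/card_gt0P; rewrite (cardsD1 e0) e0B in B_gt1.
rewrite !inE => /andP[e10 e1B].
have geq e f : e \in B -> f \in B -> f != e -> c * defect s t M f <= deficiency (B :\ e).
  exact: deficiency_geq.
(* e0 has the largest defect: pair it with e1 and every other edge with e0. *)
have sum_le : c * \sum_(e in B) defect s t M e <= \sum_(e in B) deficiency (B :\ e).
  rewrite (bigD1 e0) //= [X in _ <= X](bigD1 e0) //=.
  rewrite (bigD1 e1) ?e1B //= [X in _ <= _ + X](bigD1 e1) ?e1B //=.
  rewrite !mulnDr addnCA !addnA leq_add ?leq_add ?geq // 1?eq_sym //.
  rewrite big_distrr leq_sum // => e /andP[/andP[eB ee0] _].
  by apply: leq_trans (geq e e0 eB e0B _); rewrite 1?eq_sym // leq_mul2l e0_max ?orbT.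
exact: leq_trans (deficiency_leq BF) sum_le.
Qed.

Definition layer (i : nat) := \sum_(B in forests | #|B| == i) deficiency B.

Lemma layer_decr (i : nat) : 0 < k -> #|T| - 1 <= k -> 0 < i -> layer i.+1 <= layer i.
Proof.
move=> k_gt0 kT i_gt0; rewrite -(leq_pmul2l k_gt0).
(* The bound on [k] enters here: i >= 1 gives m - i <= m - 1 <= k. *)
apply: leq_trans (_ : (#|T| - i) * layer i <= _); last by rewrite leq_mul2r; lia.
have stepB : k * layer i.+1 <=
    \sum_(B in forests | #|B| == i.+1) \sum_(e in B) deficiency (B :\ e).
  rewrite /layer big_distrr leq_sum // => B /andP[BF /eqP cB].
  by apply: deficiency_sum => //; rewrite cB ltnS.
(* For fixed [e], removing [e] is injective from the sets of size i + 1 containing [e] to the sets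
   of size [i] avoiding it. *)
have step_e (e : T) : \sum_(B in forests | (#|B| == i.+1) && (e \in B)) deficiency (B :\ e)
    <= \sum_(C in forests | (#|C| == i) && (e \notin C)) deficiency C.
  rewrite (reindex_onto (fun C => e |: C) (fun B => B :\ e)); last first.
    by move=> B /and3P[_ _ eB]; rewrite setD1K.
  rewrite big_mkcond [X in _ <= X]big_mkcond leq_sum //= => C _.
  case: ifP => // /andP[/and3P[BF cB _] /eqP DC]; rewrite DC.
  have eNC : e \notin C by rewrite -DC !inE eqxx.
  have -> : C \in forests by rewrite -DC forestsD1.
  rewrite eNC andbT /=.
  by move: cB; rewrite cardsU1 eNC eqSS => ->.
apply: leq_trans stepB _; rewrite (exchange_big_dep predT) //=.
apply: (@leq_trans (\sum_(e : T) \sum_(C in forests | (#|C| == i) && (e \notin C)) deficiency C)).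
  by apply: leq_sum => e _; apply: leq_trans (step_e e); under eq_bigl do rewrite -andbA.
(* Summed over [e], each [C] of size [i] is counted once per edge outside it, hence at most m - i
   times. *)
rewrite (exchange_big_dep (fun C => (C \in forests) && (#|C| == i))) /=; last first.
  by move=> e C _ /and3P[-> ->].
rewrite /layer big_distrr /= leq_sum // => C /andP[CF /eqP cC].
rewrite sum_nat_const -cC leq_mul2r; apply/orP; right.
have -> : #|T| - #|C| = #|~: C| by rewrite -(cardsC C) addKn.
 move: forests CF => F CF.
apply/subset_leq_card/subsetP => e.
by rewrite !inE CF eqxx.
Qed.

(** Whitney's broken-circuit formula for the chromatic polynomial at [k]. It does not involve the
    lists, so it serves as the common value against which P(G, k) and P(G, L) are compared. *)
Definition signed_forests := (\sum_(B in forests) (-1) ^+ #|B| * (k ^ (#|V| - #|B|))%:Z)%R.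

Lemma num_colorings_deficiency :
  ((num_colorings set0 (enum T))%:Z =
   signed_forests - \sum_(B in forests) (-1) ^+ #|B| * (deficiency B)%:Z)%R.
Proof.
rewrite num_colorings_forests /signed_forests -sumrB; apply: eq_bigr => B BF.
have [r /beta_leq rB] := forests_contraction BF.
by rewrite -mulrBr /deficiency -subzn ?rB // opprB addrCA subrr addr0.
Qed.

(** The union bound gives k D(B) <= 0. This covers both constant lists and the empty edge set. *)
Lemma deficiency_eq0 (B : {set T}) : 0 < k -> B \in forests ->
  {in B, forall e, defect s t M e = 0} -> deficiency B = 0.
Proof.
move=> k_gt0 BF d0; have := deficiency_leq BF; rewrite (eq_bigr _ d0) big1_eq muln0.
by rewrite leqn0 muln_eq0 -leqn0 leqNgt k_gt0 => /eqP.
Qed.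

Lemma num_colorings_constant : 0 < k -> (forall e, defect s t M e = 0) ->
  ((num_colorings set0 (enum T))%:Z = signed_forests)%R.
Proof.
move=> k_gt0 d0; rewrite num_colorings_deficiency big1 ?subr0 // => B BF.
by rewrite deficiency_eq0 // mulr0.
Qed.

Lemma num_colorings_geq : 0 < k -> #|T| - 1 <= k ->
  (signed_forests <= (num_colorings set0 (enum T))%:Z)%R.
Proof.
move=> k_gt0 kT; rewrite num_colorings_deficiency lerDl oppr_ge0.
have card_lt (B : {set T}) : #|B| < #|T|.+1 by rewrite ltnS max_card.
rewrite (partition_big (fun B : {set T} => inord #|B| : 'I_#|T|.+1) predT) //=.
have -> : (\sum_(j < #|T|.+1) \sum_(B in forests | inord #|B| == j)
            (-1) ^+ #|B| * (deficiency B)%:Z =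
          \sum_(j < #|T|.+1) (-1) ^+ j * (layer j)%:Z)%R.
  apply: eq_bigr => j _; rewrite /layer -natz natr_sum big_distrr /=.
  apply: eq_big => [B|B /andP[_ /eqP <-]]; last by rewrite inordK // natz.
  by rewrite -val_eqE /= inordK.
(* Layer 0 vanishes, since its only possible member is the empty set. What remains is minus the
   alternating sum starting at layer 1, from where the layers decrease. *)
rewrite big_ord_recl /= {1}/layer big1 ?mulr0 ?add0r => [|B /andP[BF /eqP cB]]; last first.
  by rewrite deficiency_eq0 // => e eB; move/eqP: cB; rewrite cards_eq0 => /eqP B0; rewrite B0 inE in eB.
have [] := @andP _ _ (@alternating_sum_bounds (fun i => Posz (layer i.+1)) #|T| _ _) => //.
  by move=> i; rewrite lez_nat layer_decr.
move=> s_ge0 _; rewrite -oppr_ge0 -sumrN; move: s_ge0; congr (_ <= _)%R.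
by apply: eq_bigr => i _; rewrite /bump /= add1n exprS mulN1r mulNr opprK.
Qed.

End Lists.

End BrokenCircuits.

(** * Application to graphs and list assignments *)

Section ListColorings.

Variable G : sgraph.

Local Notation edge := {S : {set G} | S \in edges G}.

Lemma edge_ends (e : edge) : exists p : G * G, adj p.1 p.2 && (val e == [set p.1; p.2]).
Proof.
have /imsetP[p pG eE] := valP e; exists p.
by rewrite eE eqxx andbT; rewrite inE in pG.
Qed.

(** An arbitrary orientation of each edge. Indexing by unordered pairs makes the number of indices
    equal to m. *)
Definition src (e : edge) : G := (xchoose (edge_ends e)).1.
Definition tgt (e : edge) : G := (xchoose (edge_ends e)).2.

Lemma proper_ends (C : eqType) (f : G -> C) :
  [forall u, forall v, adj u v ==> (f u != f v)] =
  all (fun e => f (src e) != f (tgt e)) (enum {: edge}).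
Proof.
apply/forallP/allP => [fP e _|fP u].
  by case/andP: (xchooseP (edge_ends e)) => /(implyP (forallP (fP _) _)).
apply/forallP => v; apply/implyP => uv.
have uvE : [set u; v] \in edges G by apply/imsetP; exists (u, v); rewrite ?inE.
pose e : edge := Sub [set u; v] uvE.
have := fP e; rewrite mem_enum => /(_ isT); rewrite /src /tgt.
case/andP: (xchooseP (edge_ends e)) => _ /=; move: (xchoose _) => [x y] /= /eqP/setP E.
(* Testing {u, v} = {x, y} at [x] and [y] gives four cases; testing at [u] and [v] forces u = v in
   the degenerate ones. *)
move: (E x) (E y) (E u) (E v); rewrite !inE !eqxx ?orbT /=.
move=> /orP[]/eqP-> /orP[]/eqP-> //; rewrite ?orbb.
- by move=> _ /esym/eqP ->.
- by move=> _ _; rewrite eq_sym.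
- by move=> /esym/eqP ->.
Qed.

Lemma chromatic_funE (k : nat) :
  chromatic_fun G k = num_colorings src tgt (fun _ => [set: 'I_k]) set0 (enum {: edge}).
Proof.
apply: eq_card => f; rewrite !inE proper_ends.
have -> : [forall v : G, f v \in [set: 'I_k]] by apply/forallP => v; rewrite inE.
by have -> // : compat src tgt f set0; apply/compatP => e; rewrite inE.
Qed.

Definition palette_list (L : G -> {fset nat}) (v : G) : {set palette L} :=
  fsub (palette L) (L v).

Lemma num_list_coloringsE (L : G -> {fset nat}) :
  num_list_colorings L = num_colorings src tgt (palette_list L) set0 (enum {: edge}).
Proof.
apply: eq_card => f; rewrite !inE -proper_ends.
have -> : compat src tgt f set0 by apply/compatP => e; rewrite inE.
by congr (_ && _); apply: eq_forallb => v; rewrite in_fsub.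
Qed.

Lemma card_palette_list (L : G -> {fset nat}) (v : G) :
  #|palette_list L v| = #|` L v|%fset.
Proof. by apply/card_fsub/bigfcup_sup; rewrite ?mem_enum. Qed.

Lemma num_list_colorings_geq (L : G -> {fset nat}) (k : nat) :
  is_assignment k L -> 0 < k -> #|edges G| - 1 <= k ->
  chromatic_fun G k <= num_list_colorings L.
Proof.
move=> Lk k_gt0 km; rewrite -lez_nat chromatic_funE num_list_coloringsE.
rewrite (num_colorings_constant (k := k)) //.
- apply: num_colorings_geq => //; last by rewrite card_sig.
  by move=> v; rewrite card_palette_list; case: (Lk v).
- by move=> v; rewrite cardsT card_ord.
- by move=> e; rewrite /defect setDv cards0.
Qed.

(** Both counts equal [signed_forests], so they are compared without relabelling colours. *)
Lemma num_list_colorings_constant (A : {fset nat}) :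
  (0 < #|` A|)%fset -> num_list_colorings (fun _ : G => A) = chromatic_fun G #|` A|%fset.
Proof.
move=> A_gt0; apply/eqP; rewrite -eqz_nat chromatic_funE num_list_coloringsE.
apply/eqP; rewrite !(num_colorings_constant (k := #|` A|%fset)) //.
- by move=> v; rewrite cardsT card_ord.
- by move=> e; rewrite /defect setDv cards0.
- by move=> v; rewrite card_palette_list.
- by move=> e; rewrite /defect setDv cards0.
Qed.

End ListColorings.

Theorem corollary2 (G : sgraph) (m k : nat) (hm : #|edges G| = m)
  (hk : 0 < k) (hmk : m - 1 <= k) :
  list_color_fun G k = chromatic_fun G k.
Proof.
rewrite /list_color_fun; case: ex_minnP => n /asboolP[L Lk <-] n_min.
apply/eqP; rewrite eqn_leq num_list_colorings_geq ?hm // andbT.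
(* The constant assignment {1, ..., k} attains P(G, k), which bounds the minimum from above. *)
pose A : {fset nat} := [fset i in iota 1 k]%fset.
have cardA : #|` A|%fset = k by rewrite card_fseq undup_id ?iota_uniq // size_iota.
rewrite -{1}cardA -(@num_list_colorings_constant G) ?cardA //.
apply/n_min/asboolP; exists (fun=> A) => // v.
by split=> //; rewrite in_fset mem_iota.
Qed.
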